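(* The map $d_3:\mathrm{Ein}^{2,3}\times\mathrm{Ein}^{2,3}\to\{0,1,2,3\}$ defines a $\mathsf{G}_2'$-invariant metric on $\mathrm{Ein}^{2,3}$.
   Context: Split octonions: $\mathbb{O}'=\mathbb{H}\oplus\mathbb{H}$ with product $(a,b)\odot(c,d)=(ac+db^*,\,a^*d+cb)$ ($*$ = quaternionic conjugation) and bilinear form $(a,b)\cdot(c,d)=\langle a,c\rangle_{\mathbb{H}}-\langle b,d\rangle_{\mathbb{H}}$; $\mathrm{Im}\,\mathbb{O}'=1^\perp$; for $x,y\in\mathrm{Im}\,\mathbb{O}'$, $x\times y$ is the component of $x\odot y$ in $\mathrm{Im}\,\mathbb{O}'$. $\mathsf{G}_2'=\mathrm{Aut}_{\mathbb{R}\text{-alg}}(\mathbb{O}')$. $\mathrm{Ein}^{2,3}=\{[x]\in\mathbb{P}(\mathrm{Im}\,\mathbb{O}'): x\cdot x=0\}$. $d_3([u],[v])=0$ if $[u]=[v]$; $=1$ if $[u]\neq[v]$ and $u\times v=0$; $=2$ if $u\cdot v=0$ and $u\times v\ne0$; $=3$ if $u\cdot v\neq0$. (These four conditions partition $\mathrm{Ein}^{2,3}\times\mathrm{Ein}^{2,3}$: for null $u,v$, $u\cdot v\ne0$ implies $u\times v\neq0$.) *)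

(* Defs.v *)
From HB Require Import structures.
From mathcomp Require Import all_boot all_order all_algebra.
From mathcomp Require Import ring.
From mathcomp Require Import boolp reals.

Set Implicit Arguments.
Unset Strict Implicit.
Unset Printing Implicit Defensive.

Import Order.TTheory GRing.Theory Num.Theory.
Local Open Scope ring_scope.

Section SplitOctonions.
Variable R : realType.

(* (a0, a1, a2, a3) stands for a0 + a1 i + a2 j + a3 k *)
Definition quat : vectType R := (R^o * R^o * R^o * R^o)%type.

Definition mulq (a b : quat) : quat :=
  let: (a0, a1, a2, a3) := a : R * R * R * R in
  let: (b0, b1, b2, b3) := b : R * R * R * R in
  (a0 * b0 - a1 * b1 - a2 * b2 - a3 * b3,
   a0 * b1 + a1 * b0 + a2 * b3 - a3 * b2,
   a0 * b2 - a1 * b3 + a2 * b0 + a3 * b1,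
   a0 * b3 + a1 * b2 - a2 * b1 + a3 * b0).

Definition conjq (a : quat) : quat :=
  let: (a0, a1, a2, a3) := a : R * R * R * R in (a0, - a1, - a2, - a3).

Definition dotq (a b : quat) : R :=
  let: (a0, a1, a2, a3) := a : R * R * R * R in
  let: (b0, b1, b2, b3) := b : R * R * R * R in
  a0 * b0 + a1 * b1 + a2 * b2 + a3 * b3.

Definition oneq : quat := (1, 0, 0, 0).

Definition octo : vectType R := (quat * quat)%type.

Definition mulo (x y : octo) : octo :=
  let: (a, b) := x in
  let: (c, d) := y in
  (mulq a c + mulq d (conjq b), mulq (conjq a) d + mulq c b).

Definition doto (x y : octo) : R := dotq x.1 y.1 - dotq x.2 y.2.

Definition oneo : octo := (oneq, 0).

(* [oneo] has norm 1, so this is the projection onto the orthogonal of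
   [oneo] along the line of scalars *)
Definition imo (x : octo) : octo := x - doto oneo x *: oneo.

Definition cross (x y : octo) : octo := imo (mulo x y).

Lemma mulqE (a0 a1 a2 a3 b0 b1 b2 b3 : R) :
  mulq (a0, a1, a2, a3) (b0, b1, b2, b3) =
  (a0 * b0 - a1 * b1 - a2 * b2 - a3 * b3,
   a0 * b1 + a1 * b0 + a2 * b3 - a3 * b2,
   a0 * b2 - a1 * b3 + a2 * b0 + a3 * b1,
   a0 * b3 + a1 * b2 - a2 * b1 + a3 * b0) :> R * R * R * R.
Proof. by []. Qed.

Lemma conjqE (a0 a1 a2 a3 : R) :
  conjq (a0, a1, a2, a3) = (a0, - a1, - a2, - a3) :> R * R * R * R.
Proof. by []. Qed.

Lemma addqE (a0 a1 a2 a3 b0 b1 b2 b3 : R) :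
  ((a0, a1, a2, a3) : quat) + ((b0, b1, b2, b3) : quat) =
  (a0 + b0, a1 + b1, a2 + b2, a3 + b3) :> R * R * R * R.
Proof. by []. Qed.

Lemma oppqE (a0 a1 a2 a3 : R) :
  - ((a0, a1, a2, a3) : quat) = (- a0, - a1, - a2, - a3) :> R * R * R * R.
Proof. by []. Qed.

Lemma scaleqE (k a0 a1 a2 a3 : R) :
  k *: ((a0, a1, a2, a3) : quat) =
  (k * a0, k * a1, k * a2, k * a3) :> R * R * R * R.
Proof. by []. Qed.

Lemma dotqE (a0 a1 a2 a3 b0 b1 b2 b3 : R) :
  dotq (a0, a1, a2, a3) (b0, b1, b2, b3) =
  a0 * b0 + a1 * b1 + a2 * b2 + a3 * b3.
Proof. by []. Qed.

Lemma muloE (a b c d : quat) :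
  mulo (a, b) (c, d) =
  (mulq a c + mulq d (conjq b), mulq (conjq a) d + mulq c b).
Proof. by []. Qed.

Lemma addoE (a b c d : quat) :
  ((a, b) : octo) + ((c, d) : octo) = (a + c, b + d) :> quat * quat.
Proof. by []. Qed.

Lemma oppoE (a b : quat) : - ((a, b) : octo) = (- a, - b) :> quat * quat.
Proof. by []. Qed.

Lemma scaleoE (k : R) (a b : quat) :
  k *: ((a, b) : octo) = (k *: a, k *: b) :> quat * quat.
Proof. by []. Qed.

Lemma dotoE (a b c d : quat) : doto (a, b) (c, d) = dotq a c - dotq b d.
Proof. by []. Qed.

Lemma oneoE :
  oneo = ((1, 0, 0, 0) : R * R * R * R, (0, 0, 0, 0) : R * R * R * R).
Proof. by []. Qed.

Lemma scaleRE (k x : R) : k *: (x : R^o) = k * x :> R.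
Proof. by []. Qed.

Lemma imoE (x0 x1 x2 x3 x4 x5 x6 x7 : R) :
  imo ((x0, x1, x2, x3) : quat, (x4, x5, x6, x7) : quat) =
  ((0, x1, x2, x3) : R * R * R * R, (x4, x5, x6, x7) : R * R * R * R).
Proof.
rewrite /imo oneoE dotoE !dotqE scaleoE !scaleqE oppoE !oppqE addoE !addqE.
by congr (_, _); congr (_, _, _, _); ring.
Qed.

Definition octoE := (muloE, addoE, oppoE, scaleoE, dotoE, imoE,
  mulqE, conjqE, addqE, oppqE, scaleqE, dotqE).

Lemma octo_ind (P : octo -> Prop) :
  (forall x0 x1 x2 x3 x4 x5 x6 x7 : R,
    P ((x0, x1, x2, x3) : quat, (x4, x5, x6, x7) : quat)) -> forall x, P x.
Proof. by move=> PP [[[[x0 x1] x2] x3] [[[x4 x5] x6] x7]]. Qed.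

Ltac octo_ring :=
  rewrite /cross ?oneoE ?octoE /= ?scaleRE;
  repeat match goal with |- (_, _) = (_, _) => congr (_, _) end; ring.

Lemma dotoDr k x y z : doto x (k *: y + z) = k * doto x y + doto x z.
Proof.
elim/octo_ind: x => x0 x1 x2 x3 x4 x5 x6 x7.
elim/octo_ind: y => y0 y1 y2 y3 y4 y5 y6 y7.
elim/octo_ind: z => z0 z1 z2 z3 z4 z5 z6 z7.
octo_ring.
Qed.

Lemma doto_is_linear x : linear (doto x : octo -> R^o).
Proof. move=> k y z; exact: dotoDr. Qed.

HB.instance Definition _ x := GRing.isLinear.Build R octo R^o *:%R
  (doto x : octo -> R^o) (doto_is_linear x).

Definition ImO : {vspace octo} := lker (linfun (doto oneo : octo -> R^o)).

Lemma mem_ImO x : (x \in ImO) = (doto oneo x == 0).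
Proof. by rewrite memv_ker lfunE. Qed.

(* [Ein] is Ein^{2,3}: a point [x] of the projective space P(Im O') is the
   line spanned by [x], and [x] is null when this line is. *)
Definition is_null_line (L : {vspace octo}) : bool :=
  [&& \dim L == 1%N, (L <= ImO)%VS & `[< forall x, x \in L -> doto x x = 0 >]].

Record Ein := MkEin {
  ein_line :> {vspace octo};
  ein_lineP : is_null_line ein_line }.

HB.instance Definition _ := [isSub for ein_line].
HB.instance Definition _ := [Choice of Ein by <:].

(* [vpick p] is a representative of [p]; see [d3P] below for the independence
   of the choice *)
Definition d3 (p q : Ein) : 'I_4 :=
  let u := vpick p in
  let v := vpick q in
  if p == q then inord 0
  else if cross u v == 0 then inord 1
  else if doto u v == 0 then inord 2
  else inord 3.

(* G_2': preservation of the unit follows, see [G2_one] *)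
Record G2 := MkG2 {
  G2_fun :> 'End(octo);
  G2_bij : bijective G2_fun;
  G2_mul : forall x y, G2_fun (mulo x y) = mulo (G2_fun x) (G2_fun y) }.

Lemma mul1o x : mulo oneo x = x.
Proof. elim/octo_ind: x => x0 x1 x2 x3 x4 x5 x6 x7; octo_ring. Qed.

Lemma mulo1 x : mulo x oneo = x.
Proof. elim/octo_ind: x => x0 x1 x2 x3 x4 x5 x6 x7; octo_ring. Qed.

Lemma mulo_sqr x : mulo x x = (doto oneo x *+ 2) *: x - doto x x *: oneo.
Proof. elim/octo_ind: x => x0 x1 x2 x3 x4 x5 x6 x7; octo_ring. Qed.

Lemma doto11 : doto oneo oneo = 1.
Proof. octo_ring. Qed.

Lemma dotoZZ a b x y : doto (a *: x) (b *: y) = a * b * doto x y.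
Proof.
elim/octo_ind: x => x0 x1 x2 x3 x4 x5 x6 x7.
elim/octo_ind: y => y0 y1 y2 y3 y4 y5 y6 y7.
octo_ring.
Qed.

Lemma muloZZ a b x y : mulo (a *: x) (b *: y) = (a * b) *: mulo x y.
Proof.
elim/octo_ind: x => x0 x1 x2 x3 x4 x5 x6 x7.
elim/octo_ind: y => y0 y1 y2 y3 y4 y5 y6 y7.
octo_ring.
Qed.

Lemma crossZZ a b x y : cross (a *: x) (b *: y) = (a * b) *: cross x y.
Proof.
rewrite /cross muloZZ /imo scalerBr; congr (_ - _).
by rewrite linearZ /= scaleRE scalerA.
Qed.

Lemma crossx0 x : cross x 0 = 0.
Proof.
by rewrite -(scale0r (0 : octo)) -[x in cross x]scale1r crossZZ mulr0 2!scale0r.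
Qed.

Lemma crossE (x1 x2 x3 x4 x5 x6 x7 y1 y2 y3 y4 y5 y6 y7 : R) :
  cross ((0, x1, x2, x3) : quat, (x4, x5, x6, x7) : quat)
        ((0, y1, y2, y3) : quat, (y4, y5, y6, y7) : quat) =
  ((0,
    x2 * y3 - x3 * y2 - y4 * x5 + y5 * x4 - y6 * x7 + y7 * x6,
    x3 * y1 - x1 * y3 - y4 * x6 + y5 * x7 + y6 * x4 - y7 * x5,
    x1 * y2 - x2 * y1 - y4 * x7 - y5 * x6 + y6 * x5 + y7 * x4)
      : R * R * R * R,
   (x1 * y5 + x2 * y6 + x3 * y7 - y1 * x5 - y2 * x6 - y3 * x7,
    - x1 * y4 - x2 * y7 + x3 * y6 + y1 * x4 + y2 * x7 - y3 * x6,
    x1 * y7 - x2 * y4 - x3 * y5 - y1 * x7 + y2 * x4 + y3 * x5,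
    - x1 * y6 + x2 * y5 - x3 * y4 + y1 * x6 - y2 * x5 + y3 * x4)
      : R * R * R * R).
Proof. octo_ring. Qed.

Lemma cross_cross x y : x \in ImO -> y \in ImO ->
  cross x (cross x y) = doto x y *: x - doto x x *: y.
Proof.
rewrite !mem_ImO.
elim/octo_ind: x => x0 x1 x2 x3 x4 x5 x6 x7.
elim/octo_ind: y => y0 y1 y2 y3 y4 y5 y6 y7.
rewrite !oneoE !dotoE !dotqE !(mul1r, mul0r, addr0, subr0) => /eqP-> /eqP->.
rewrite !crossE !scaleoE !scaleqE.
rewrite oppoE !oppqE addoE !addqE.
by repeat match goal with |- (_, _) = (_, _) => congr (_, _) end; ring.
Qed.

Lemma ein_rep (p : Ein) u : u \in ein_line p -> u != 0 ->
  exists2 a, a != 0 & u = a *: vpick p.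
Proof.
case: p => L /= /and3P[/eqP dL _ _] uL u0.
have Lu : (<[u]> = L)%VS.
  by apply/eqP; rewrite eqEdim dim_vline u0 dL leqnn andbT -memvE.
have p0 : vpick L != 0 by rewrite vpick0 -dimv_eq0 dL.
have /vlineP[k kE] : vpick L \in <[u]>%VS by rewrite Lu memv_pick.
have k0 : k != 0 by apply: contraNneq p0 => k0; rewrite kE k0 scale0r.
by exists k^-1; rewrite ?invr_eq0// kE scalerA mulVf// scale1r.
Qed.

(* The value of [d3] may be computed from arbitrary representatives. *)
Lemma d3P (p q : Ein) u v :
    u \in ein_line p -> u != 0 -> v \in ein_line q -> v != 0 ->
  [/\ p = q -> d3 p q = 0%N :> nat,
      p != q -> cross u v = 0 -> d3 p q = 1%N :> nat,
      doto u v = 0 -> cross u v != 0 -> d3 p q = 2%N :> nat &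
      doto u v != 0 -> d3 p q = 3%N :> nat].
Proof.
move=> up u0 vq v0.
have nullP (r : Ein) x : x \in ein_line r -> doto x x = 0 /\ x \in ImO.
  case: r => L /= /and3P[_ /subvP sL /asboolP nL] xL; split; first exact: nL.
  exact: sL.
have [uu uI] := nullP _ _ up; have [_ vI] := nullP _ _ vq.
have cross0 : cross u v = 0 -> doto u v = 0.
  move=> c0; have := cross_cross uI vI.
  rewrite c0 crossx0 uu scale0r subr0 => /esym/eqP.
  by rewrite scaler_eq0 (negPf u0) orbF => /eqP.
have [a a0 uE] := ein_rep up u0; have [b b0 vE] := ein_rep vq v0.
have ab0 : a * b != 0 by rewrite mulf_neq0.
have cE : (cross (vpick p) (vpick q) == 0) = (cross u v == 0).
  by rewrite uE vE crossZZ scaler_eq0 (negPf ab0).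
have dE : (doto (vpick p) (vpick q) == 0) = (doto u v == 0).
  by rewrite uE vE dotoZZ mulf_eq0 (negPf ab0).
have eq_cross : p = q -> cross u v = 0 /\ doto u v = 0.
  move=> pq; move: vE; rewrite -pq => vE.
  have dpp : doto (vpick p) (vpick p) = 0 by case: (nullP p _ (memv_pick p)).
  have duv : doto u v = 0 by rewrite uE vE dotoZZ dpp mulr0.
  suff ?: cross u v = 0 by split.
  have -> : cross u v = (a * b) *: cross (vpick p) (vpick p).
    by rewrite uE vE crossZZ.
  suff -> : cross (vpick p) (vpick p) = 0 by rewrite scaler0.
  have := (nullP p _ (memv_pick p)).2; rewrite mem_ImO => /eqP p1.
  rewrite /cross /imo mulo_sqr dpp p1 mul0rn scale0r scale0r subr0.
  by rewrite linear0 scale0r subr0.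
rewrite /d3 cE dE; split.
- by move=> ->; rewrite eqxx inordK.
- by move=> /negPf-> ->; rewrite eqxx inordK.
- move=> d0 c0; rewrite d0 (negPf c0) eqxx.
  case: eqP => [/eq_cross[/eqP]|_]; first by rewrite (negPf c0).
  by rewrite inordK.
- move=> d0; rewrite (negPf d0).
  have /negPf-> : cross u v != 0 by apply: contraNneq d0 => /cross0 ->.
  case: eqP => [/eq_cross[_ /eqP]|_]; first by rewrite (negPf d0).
  by rewrite inordK.
Qed.

Lemma G2_one (g : G2) : g oneo = oneo.
Proof.
have [h hK gK] := G2_bij g.
by have := G2_mul g oneo (h oneo); rewrite mul1o gK mulo1.
Qed.

Lemma G2_ImO (g : G2) x : x \in ImO ->
  g x \in ImO /\ doto (g x) (g x) = doto x x.
Proof.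
rewrite !mem_ImO => /eqP x1.
have ginj := bij_inj (G2_bij g).
have o0 : oneo != 0.
  apply/eqP => o0; have := doto11.
  by rewrite o0 linear0 => /eqP; rewrite eq_sym oner_eq0.
have := G2_mul g x x.
rewrite !mulo_sqr x1 mul0rn scale0r sub0r linearN linearZ /= G2_one.
set r := doto oneo (g x); move=> E.
have E2 : (r *+ 2) *: g x = (doto (g x) (g x) - doto x x) *: oneo.
  by rewrite scalerBl E addrC subrK.
have r0 : r = 0.
  apply/eqP; apply: contraTT isT => r0.
  have r20 : r *+ 2 != 0 by rewrite mulrn_eq0.
  pose c := (r *+ 2)^-1 * (doto (g x) (g x) - doto x x).
  have gx : g x = c *: oneo by rewrite -scalerA -E2 scalerA mulVf// scale1r.
  have xE : x = c *: oneo by apply: ginj; rewrite gx linearZ /= G2_one.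
  have c0 : c = 0 by rewrite -x1 xE linearZ /= doto11 /GRing.scale /= mulr1.
  by move: r0; rewrite /r gx c0 scale0r linear0 eqxx.
split; first by rewrite r0.
move: E2; rewrite r0 mul0rn scale0r => /esym/eqP.
by rewrite scaler_eq0 (negPf o0) orbF subr_eq0 => /eqP.
Qed.

Lemma G2_null_line (g : G2) (p : Ein) : is_null_line (g @: p)%VS.
Proof.
case: p => L /= /and3P[/eqP dL /subvP sL /asboolP nL].
have ginj := bij_inj (G2_bij g).
have k0 : lker g = 0%VS by apply/eqP/lker0P.
apply/and3P; split.
- by rewrite limg_dim_eq ?dL// k0 capv0.
- apply/subvP => _ /memv_imgP[x xL ->].
  by case: (G2_ImO g (sL _ xL)).
- apply/asboolP => _ /memv_imgP[x xL ->].
  by case: (G2_ImO g (sL _ xL)) => _ ->; exact: nL.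
Qed.

(* g.[x] = [g x] *)
Definition G2_act (g : G2) (p : Ein) : Ein := MkEin (G2_null_line g p).

End SplitOctonions.

Record is_metric (R : realType) (T : Type) (d : T -> T -> R) : Prop := {
  metric_ge0 : forall x y, 0 <= d x y;
  metric_eq0 : forall x y, d x y = 0 <-> x = y;
  metric_sym : forall x y, d x y = d y x;
  metric_triangle : forall x y z, d x z <= d x y + d y z }.

(* Main.v *)
Require Import Defs.
From mathcomp Require Import all_boot all_order all_algebra.
From mathcomp Require Import boolp reals.
From mathcomp Require Import ring zify.
Import GRing.Theory Num.Theory.
Local Open Scope ring_scope.

(** Since [d3] takes the values 0, 1, 2, 3, the triangle inequality can fail
    only where two distances 1 would add up to a distance 3.  So it amounts to
    one algebraic fact: for nonzero [u], [v], [w] in Im O' with [u] and [w]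
    null, if [u x v = 0] and [v x w = 0] then [u . w = 0]
    ([doto_of_cross0]).  This comes from the double product identity
      [a x (a x b) = (a . b) a - (a . a) b],
    polarised in [a] ([cross_polar]):
      [u x (w x v) + w x (u x v) = (u . v) w + (w . v) u - 2 (u . w) v].
    The left side vanishes, and so do [u . v] and [w . v], because the
    annihilator of a nonzero null vector is orthogonal to it
    ([cross0_doto0]); hence [2 (u . w) v = 0].

    Symmetry is the antisymmetry of the cross product together with the
    symmetry of the bilinear form.

    For invariance, an automorphism [g] fixes 1 and preserves Im O', so it
    commutes with the projection to Im O' ([G2_imo]), hence with the cross
    product ([G2_cross]).  It also preserves the real part, from which the
    bilinear form is recovered as
      [x . y = 2 Re x Re y - Re (x y)]  ([doto_mulo]). *)

Ltac octo_ring :=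
  rewrite /cross ?oneoE ?octoE /= ?scaleRE;
  repeat match goal with |- (_, _) = (_, _) => congr (_, _) end; ring.

Section Cross.
Variable R : realType.
Implicit Types x y z : octo R.

Lemma dotoC x y : doto x y = doto y x.
Proof.
elim/octo_ind: x => x0 x1 x2 x3 x4 x5 x6 x7.
elim/octo_ind: y => y0 y1 y2 y3 y4 y5 y6 y7.
octo_ring.
Qed.

Lemma doto_addr x y z : doto x (y + z) = doto x y + doto x z.
Proof. by rewrite linearD. Qed.

Lemma doto_scaler k x y : doto x (k *: y) = k * doto x y.
Proof. by rewrite -[k *: y]addr0 dotoDr linear0 addr0. Qed.

Lemma doto_addl x y z : doto (x + y) z = doto x z + doto y z.
Proof. by rewrite dotoC doto_addr !(dotoC z). Qed.

Lemma crossDl x y z : cross (x + y) z = cross x z + cross y z.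
Proof.
elim/octo_ind: x => x0 x1 x2 x3 x4 x5 x6 x7.
elim/octo_ind: y => y0 y1 y2 y3 y4 y5 y6 y7.
elim/octo_ind: z => z0 z1 z2 z3 z4 z5 z6 z7.
octo_ring.
Qed.

Lemma crossDr x y z : cross x (y + z) = cross x y + cross x z.
Proof.
elim/octo_ind: x => x0 x1 x2 x3 x4 x5 x6 x7.
elim/octo_ind: y => y0 y1 y2 y3 y4 y5 y6 y7.
elim/octo_ind: z => z0 z1 z2 z3 z4 z5 z6 z7.
octo_ring.
Qed.

(** The square of an imaginary octonion is a scalar ([mulo_sqr]), and [imo]
    kills scalars. *)
Lemma crossxx x : x \in ImO R -> cross x x = 0.
Proof.
rewrite mem_ImO => /eqP x1.
rewrite /cross mulo_sqr x1 mul0rn scale0r sub0r -scaleNr /imo doto_scaler.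
by rewrite doto11 mulr1 subrr.
Qed.

Lemma crossC x y : x \in ImO R -> y \in ImO R -> cross y x = - cross x y.
Proof.
move=> xI yI; apply/eqP; rewrite -addr_eq0 addrC.
have := crossxx (x + y) (memvD xI yI).
rewrite crossDl !crossDr (crossxx x xI) (crossxx y yI).
by move: (cross x y) (cross y x) => a b; rewrite add0r addr0 => ->.
Qed.

Lemma cross_eq0C x y : x \in ImO R -> y \in ImO R ->
  (cross y x == 0) = (cross x y == 0).
Proof. by move=> xI yI; rewrite (crossC x y xI yI) oppr_eq0. Qed.

(** Applying [cross x] to [cross x y = 0] gives [doto x y *: x = 0], because
    [x] is null. *)
Lemma cross0_doto0 x y : x \in ImO R -> y \in ImO R -> doto x x = 0 ->
  x != 0 -> cross x y = 0 -> doto x y = 0.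
Proof.
move=> xI yI xx x0 c0; have := cross_cross xI yI.
rewrite c0 crossx0 xx scale0r subr0 => /esym/eqP.
by rewrite scaler_eq0 (negPf x0) orbF => /eqP.
Qed.

(** The part of [cross_cross] for [x + z] that is linear in both [x] and
    [z]. *)
Lemma cross_polar x y z : x \in ImO R -> y \in ImO R -> z \in ImO R ->
  cross x (cross z y) + cross z (cross x y)
  = doto x y *: z + doto z y *: x - (doto x z *+ 2) *: y.
Proof.
move=> xI yI zI.
have := cross_cross (memvD xI zI) yI.
move: (cross_cross xI yI) (cross_cross zI yI).
rewrite (crossDl x z y) (crossDl x z (cross x y + cross z y)).
rewrite (crossDr x (cross x y) (cross z y)) (crossDr z (cross x y) (cross z y)).
rewrite !doto_addl !doto_addr (dotoC z x) => {xI yI zI}.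
move: (cross x (cross x y)) (cross x (cross z y)).
move: (cross z (cross x y)) (cross z (cross z y)) => d b a c aE bE E.
have -> : c + d = a + c + (d + b) - (a + b).
  by rewrite (addrC d) addrACA [RHS]addrC addKr.
rewrite E {}aE {}bE => {E a b c d}.
(* With the scalars abstracted, an identity linear in the vectors [x], [y],
   [z] remains; it is checked on coordinates. *)
move: (doto x y) (doto z y) (doto x x) (doto x z) (doto z z) => a b k m n.
elim/octo_ind: x => x0 x1 x2 x3 x4 x5 x6 x7.
elim/octo_ind: y => y0 y1 y2 y3 y4 y5 y6 y7.
elim/octo_ind: z => z0 z1 z2 z3 z4 z5 z6 z7.
octo_ring.
Qed.

(** In [cross_polar] every term but [(doto x z *+ 2) *: y] vanishes. *)
Lemma doto_of_cross0 x y z : x \in ImO R -> y \in ImO R -> z \in ImO R ->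
    doto x x = 0 -> doto z z = 0 ->
    x != 0 -> y != 0 -> z != 0 ->
  cross x y = 0 -> cross y z = 0 -> doto x z = 0.
Proof.
move=> xI yI zI xx zz x0 y0 z0 xy yz.
have zy : cross z y = 0 by apply/eqP; rewrite (cross_eq0C y z yI zI) yz.
have := cross_polar x y z xI yI zI.
rewrite xy zy !crossx0 (cross0_doto0 x y xI yI xx x0 xy).
rewrite (cross0_doto0 z y zI yI zz z0 zy).
rewrite !scale0r !add0r => /esym/eqP.
by rewrite oppr_eq0 scaler_eq0 (negPf y0) orbF mulrn_eq0 => /eqP.
Qed.

(** It follows that a linear map that respects the product and the real part
    preserves the bilinear form. *)
Lemma doto_mulo x y :
  doto x y = (doto (oneo R) x * doto (oneo R) y) *+ 2
             - doto (oneo R) (mulo x y).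
Proof.
elim/octo_ind: x => x0 x1 x2 x3 x4 x5 x6 x7.
elim/octo_ind: y => y0 y1 y2 y3 y4 y5 y6 y7.
octo_ring.
Qed.

Lemma imo_ImO x : imo x \in ImO R.
Proof. by rewrite mem_ImO /imo linearB /= doto_scaler doto11 mulr1 subrr. Qed.

End Cross.

Section Automorphisms.
Variable R : realType.
Implicit Types (g : G2 R) (x y : octo R).

(** [g] preserves both summands of the decomposition of O' into scalars and
    imaginary octonions, and it is the identity on the first. *)
Lemma G2_re g x : doto (oneo R) (g x) = doto (oneo R) x.
Proof.
rewrite -[x in LHS](subrK (doto (oneo R) x *: oneo R)) -/(imo x).
rewrite linearD linearZ /= G2_one doto_addr doto_scaler doto11 mulr1.
have [+ _] := G2_ImO g (imo_ImO R x).
by rewrite mem_ImO => /eqP ->; rewrite add0r.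
Qed.

Lemma G2_imo g x : g (imo x) = imo (g x).
Proof. by rewrite /imo linearB linearZ /= G2_one G2_re. Qed.

Lemma G2_cross g x y : cross (g x) (g y) = g (cross x y).
Proof. by rewrite /cross -G2_mul G2_imo. Qed.

Lemma G2_doto g x y : doto (g x) (g y) = doto x y.
Proof. by rewrite (doto_mulo _ (g x)) (doto_mulo _ x) -G2_mul !G2_re. Qed.

Lemma G2_eq0 g x : (g x == 0) = (x == 0).
Proof. exact: raddf_eq0 (bij_inj (G2_bij g)). Qed.

Lemma G2_act_inj g : injective (G2_act g).
Proof.
move=> p q /(congr1 (@ein_line R)) /= /eqP; rewrite eq_limg_ker0.
  by move=> /eqP; exact: val_inj.
by apply/lker0P; exact: bij_inj (G2_bij g).
Qed.

End Automorphisms.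

Section Distance.
Variable R : realType.
Implicit Types (p q : Ein R) (u v : octo R).

Lemma ein_mem p u : u \in ein_line p -> u \in ImO R /\ doto u u = 0.
Proof.
case: p => L /= /and3P[_ /subvP sL /asboolP nL] uL.
by split; [exact: sL | exact: nL].
Qed.

Lemma ein_vpick_neq0 p : vpick p != 0.
Proof. by case: p => L /= /and3P[/eqP dL _ _]; rewrite vpick0 -dimv_eq0 dL. Qed.

Lemma d3_rep p q u v :
    u \in ein_line p -> u != 0 -> v \in ein_line q -> v != 0 ->
  d3 p q = (if p == q then 0%N else if cross u v == 0 then 1%N
            else if doto u v == 0 then 2%N else 3%N) :> nat.
Proof.
move=> up u0 vq v0; have [d0 d1 d2 d3] := d3P up u0 vq v0.
case: eqP => [/d0//|/eqP pq]; case: eqP => [/d1->//|/eqP c0].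
by case: eqP => [/d2->//|/eqP /d3].
Qed.

Lemma d3_pick p q :
  d3 p q = (if p == q then 0%N
            else if cross (vpick p) (vpick q) == 0 then 1%N
            else if doto (vpick p) (vpick q) == 0 then 2%N else 3%N) :> nat.
Proof. by apply: d3_rep; rewrite ?memv_pick ?ein_vpick_neq0. Qed.

Lemma d3_eq0 p q : (d3 p q == 0%N :> nat) = (p == q).
Proof. by rewrite d3_pick; do ?case: ifP. Qed.

Lemma d3C p q : d3 p q = d3 q p.
Proof.
apply: val_inj => /=; rewrite !d3_pick eq_sym dotoC cross_eq0C//.
- by case: (ein_mem q _ (memv_pick q)).
- by case: (ein_mem p _ (memv_pick p)).
Qed.

Lemma d3_eq1 p q : d3 p q = 1%N :> nat -> cross (vpick p) (vpick q) = 0.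
Proof. by rewrite d3_pick; case: ifP => // _; case: eqP => // _; case: ifP. Qed.

Lemma d3_le2 p q : doto (vpick p) (vpick q) = 0 -> (d3 p q <= 2)%N.
Proof. by rewrite d3_pick => ->; rewrite eqxx; do ?case: ifP. Qed.

(** For distinct consecutive points both summands are at least 1, and the left
    side is at most 3; only the case 1 + 1 is left to [doto_of_cross0]. *)
Lemma d3_triangle p q r : (d3 p r <= d3 p q + d3 q r)%N.
Proof.
have [->|pq] := eqVneq p q; first exact: leq_addl.
have [->|qr] := eqVneq q r; first exact: leq_addr.
have dpq : (0 < d3 p q)%N by rewrite lt0n d3_eq0.
have dqr : (0 < d3 q r)%N by rewrite lt0n d3_eq0.
have dpr : (d3 p r <= 3)%N by rewrite -ltnS.
have [d2|] := ltnP 2 (d3 p q + d3 q r); first exact: leq_trans dpr d2.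
move=> d2; have [d1 d1'] : d3 p q = 1%N :> nat /\ d3 q r = 1%N :> nat by lia.
have [pI pp] := ein_mem p _ (memv_pick p).
have [qI _] := ein_mem q _ (memv_pick q).
have [rI rr] := ein_mem r _ (memv_pick r).
rewrite d1 d1'; apply: d3_le2.
exact: (doto_of_cross0 R _ _ _ pI qI rI pp rr (ein_vpick_neq0 p)
  (ein_vpick_neq0 q) (ein_vpick_neq0 r) (d3_eq1 _ _ d1) (d3_eq1 _ _ d1')).
Qed.

(** If [u] and [v] represent [p] and [q], then [g u] and [g v] represent
    their images, and the three conditions of [d3_rep] are unchanged. *)
Lemma d3_G2 (g : G2 R) p q : d3 (G2_act g p) (G2_act g q) = d3 p q.
Proof.
apply: val_inj; rewrite /= [RHS]d3_pick.
rewrite (d3_rep _ _ (g (vpick p)) (g (vpick q))) ?memv_img ?memv_pick//;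
  rewrite ?G2_eq0 ?ein_vpick_neq0//.
by rewrite (inj_eq (G2_act_inj R g)) G2_cross G2_eq0 G2_doto.
Qed.

End Distance.

Theorem lemma8p5 (R : realType) :
  is_metric (fun p q : Ein R => (d3 p q)%:R : R) /\
  (forall (g : G2 R) (p q : Ein R), d3 (G2_act g p) (G2_act g q) = d3 p q).
Proof.
split; last exact: d3_G2.
split=> [p q|p q|p q|p q r].
- exact: ler0n.
- split=> [/eqP|->]; first by rewrite pnatr_eq0 d3_eq0 => /eqP.
  by apply/eqP; rewrite pnatr_eq0 d3_eq0.
- by rewrite d3C.
- by rewrite -natrD ler_nat d3_triangle.
Qed.
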